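(* Let $F$ be a field of characteristic zero. For any $\epsilon\in F$, any proper subvariety of $\mathrm{var}^{tr}(C_2^{t_{\epsilon,1}})$ generated by a finite dimensional algebra with trace has polynomial growth.
   Context: $F$ is a field of characteristic 0. An algebra with trace is a unitary associative $F$-algebra $A$ with an $F$-linear map $\mathrm{tr}:A\to F$ such that $\mathrm{tr}(ab)=\mathrm{tr}(ba)$; a scalar is identified with the corresponding multiple of $1_A$. The free algebra with trace $F\langle X,\mathrm{Tr}\rangle\cong F\langle X\rangle\otimes F[\mathrm{Tr}(M)]$ on $X=\{x_1,x_2,\dots\}$ is generated by the free unitary associative algebra $F\langle X\rangle$ and central commuting indeterminates $\mathrm{Tr}(M)$, $M$ a nonempty word in $X$, subject to $\mathrm{Tr}(MN)=\mathrm{Tr}(NM)$ and $\mathrm{Tr}(\mathrm{Tr}(M)N)=\mathrm{Tr}(M)\mathrm{Tr}(N)$. An element is a trace identity of $A$ if it becomes $0$ whenever the variables are replaced by arbitrary elements of $A$ and $\mathrm{Tr}$ by $\mathrm{tr}$; $\mathrm{Id}^{tr}(A)$ is the set of trace identities of $A$. $MT_n$ is the space of multilinear elements of $F\langle X,\mathrm{Tr}\rangle$ in $x_1,\dots,x_n$ (the span of all products of traces of words times a word in which each of $x_1,\dots,x_n$ occurs exactly once in total), and $c_n^{tr}(A)=\dim_F MT_n/(MT_n\cap \mathrm{Id}^{tr}(A))$. The variety $\mathrm{var}^{tr}(A)$ generated by $A$ is the class of all algebras with trace satisfying all trace identities of $A$; it has polynomial growth if $c_n^{tr}(A)$ is bounded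 above by a polynomial in $n$. $C_2=\left\{\begin{pmatrix}a&b\\0&a\end{pmatrix}:a,b\in F\right\}$, and $C_2^{t_{\epsilon,1}}$ is $C_2$ with trace $t_{\epsilon,1}\begin{pmatrix}a&b\\0&a\end{pmatrix}=\epsilon a+b$. *)

(* Defs.v *)
From HB Require Import structures.
From mathcomp Require Export all_boot all_order all_algebra.
From mathcomp Require Export finmap.
From mathcomp.multinomials Require Export monalg.

Set Implicit Arguments.
Unset Strict Implicit.
Unset Printing Implicit Defensive.

Import GRing.Theory Num.Theory.
Local Open Scope ring_scope.

(* An [algType] satisfies 1 <> 0, so that F embeds in A as the multiples of 1. *)
Record trAlgebra (F : fieldType) := TrAlgebra {
  tr_sort :> algType F;
  tr : {scalar tr_sort};
  trC : forall a b : tr_sort, tr (a * b) = tr (b * a)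
}.
Arguments tr {F t}.

(* The variable x_(i+1) is the natural number i. *)
Definition word := {w : seq nat | w != [::]}.

Definition rotates (u v : word) : bool :=
  [exists k : 'I_(size (val u)), rot k (val u) == val v].

Lemma rotatesP (u v : word) :
  reflect (exists k, rot k (val u) = val v) (rotates u v).
Proof.
apply: (iffP existsP) => [[k /eqP e]|[k e]]; first by exists k.
have u0 : (0 < size (val u))%N by case: u {e} => [[]].
have [ltk|lek] := ltnP k (size (val u)).
  by exists (Ordinal ltk); apply/eqP.
by exists (Ordinal u0); rewrite rot0 -e rot_oversize.
Qed.

Lemma rotates_refl : reflexive rotates.
Proof. by move=> u; apply/rotatesP; exists 0%N; rewrite rot0. Qed.

Lemma rotates_sym : symmetric rotates.
Proof.
have sub u v : rotates u v -> rotates v u.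
  move=> /rotatesP[k e]; apply/rotatesP; exists (size (val v) - k)%N.
  by rewrite -[RHS](rotK k) e /rotr -e size_rot.
by move=> u v; apply/idP/idP; apply: sub.
Qed.

Lemma rotates_trans : transitive rotates.
Proof.
move=> v u w /rotatesP[k e] /rotatesP[l f]; apply/rotatesP.
rewrite -f -e rot_rot_add; by eexists.
Qed.

Canonical rotates_equiv :=
  EquivRel rotates rotates_refl rotates_sym rotates_trans.

(* Nonempty words modulo MN ~ NM: the indeterminates Tr(M). *)
Definition cycword := {eq_quot rotates}%qT.
HB.instance Definition _ := Choice.on cycword.

Definition cycword_seq (c : cycword) : seq nat := val (repr c).

(* The pair (m, w) is the monomial (\prod_c Tr(c) ^ m(c)) w. *)
Definition trmonom := ({cmonom cycword} * {fmonom nat})%type.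
HB.instance Definition _ := Choice.on trmonom.

Definition trmonom_one : trmonom := (mone, mone).
Definition trmonom_mul (m1 m2 : trmonom) : trmonom :=
  (mmul m1.1 m2.1, mmul m1.2 m2.2).

Lemma trmonom_mulA : associative trmonom_mul.
Proof. by move=> x y z; rewrite /trmonom_mul /= !mulmA. Qed.

Lemma trmonom_mul1m : left_id trmonom_one trmonom_mul.
Proof. by move=> [x y]; rewrite /trmonom_mul /= !mul1m. Qed.

Lemma trmonom_mulm1 : right_id trmonom_one trmonom_mul.
Proof. by move=> [x y]; rewrite /trmonom_mul /= !mulm1. Qed.

Lemma trmonom_unitm (x y : trmonom) :
  trmonom_mul x y = trmonom_one -> x = trmonom_one /\ y = trmonom_one.
Proof.
by case: x y => [x1 x2] [y1 y2] [] /unitm[-> ->] /unitm[-> ->].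
Qed.

HB.instance Definition _ := Choice_isMonomialDef.Build trmonom
  trmonom_mulA trmonom_mul1m trmonom_mulm1 trmonom_unitm.

(* F<X, Tr>: the algebra of a product of monoids is the tensor product of
   the algebras of its factors, here F[Tr(M)] and F<X>. *)
Notation freeTr F := {malg F[trmonom]}.

Section Identities.
Variable F : fieldType.
Implicit Types (A B : trAlgebra F) (n : nat).

Definition word_eval A (v : nat -> A) (w : seq nat) : A := \prod_(i <- w) v i.

Lemma tr_word_eval_pi A (v : nat -> A) (w : word) :
  tr (word_eval v (cycword_seq (\pi_cycword w)%qT)) = tr (word_eval v (val w)).
Proof.
rewrite /cycword_seq; have /eqquotP/rotatesP[k <-] : (w = repr (\pi_cycword w) %[mod cycword])%qT.
  by rewrite reprK.
by rewrite /word_eval /rot big_cat trC -big_cat cat_take_drop.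
Qed.

Definition trmonom_eval A (v : nat -> A) (m : trmonom) : A :=
  (\prod_(c <- finsupp m.1) tr (word_eval v (cycword_seq c)) ^+ m.1 c)
    *: word_eval v m.2.

Definition tr_eval A (v : nat -> A) (f : freeTr F) : A :=
  mmap (in_alg A) (trmonom_eval v) f.

Definition trace_identity A (f : freeTr F) : Prop :=
  forall v : nat -> A, tr_eval v f = 0.

Definition trmonom_count (i : nat) (m : trmonom) : nat :=
  (\sum_(c <- finsupp m.1) m.1 c * count_mem i (cycword_seq c)
   + count_mem i (m.2 : seq nat))%N.

Definition multilinear_trmonom n (m : trmonom) : Prop :=
  forall i, trmonom_count i m = (i < n)%N.

Definition MT n (f : freeTr F) : Prop :=
  forall m, m \in msupp f -> multilinear_trmonom n m.

(* [b] represents a basis of U / (U `&` W). *)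
Definition quotient_dim (V : lmodType F) (U W : V -> Prop) (d : nat) : Prop :=
  exists b : 'I_d -> V,
    [/\ forall i, U (b i),
        forall a : 'I_d -> F,
          U (\sum_i a i *: b i) /\ W (\sum_i a i *: b i) -> forall i, a i = 0
      & forall u, U u -> exists a : 'I_d -> F,
          U (u - \sum_i a i *: b i) /\ W (u - \sum_i a i *: b i)].

(* [trace_codim A n d] stands for c_n^tr(A) = d. *)
Definition trace_codim A n (d : nat) : Prop :=
  quotient_dim (MT n) (trace_identity A) d.

Definition trace_variety := trAlgebra F -> Prop.

Definition var_tr A : trace_variety :=
  fun B => forall f, trace_identity A f -> trace_identity B f.

Definition proper_subvariety (V W : trace_variety) : Prop :=
  (forall B, V B -> W B) /\ ~ (forall B, W B -> V B).

(* Growth of the variety generated by A. *)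
Definition polynomial_growth A : Prop :=
  exists p : {poly rat}, forall n,
    exists2 d, trace_codim A n d & d%:R <= p.[n%:R].

Definition finite_dimensional (V : lmodType F) : Prop :=
  exists d (b : 'I_d -> V), forall v, exists a : 'I_d -> F,
    v = \sum_i a i *: b i.

End Identities.

Section C2.
Variable F : fieldType.

Definition C2_pred : {pred 'M[F]_2} :=
  [pred M : 'M[F]_2 | (M 1 0 == 0) && (M 0 0 == M 1 1)].

Lemma C2_subalg_closed : subalg_closed C2_pred.
Proof.
split=> [|a u v|u v]; rewrite !inE.
- by rewrite !mxE /= !eqxx.
- by move=> /andP[/eqP u0 /eqP u1] /andP[/eqP v0 /eqP v1];
     rewrite !mxE u0 v0 u1 v1 mulr0 addr0 !eqxx.
- move=> /andP[/eqP u0 /eqP u1] /andP[/eqP v0 /eqP v1].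
  rewrite !mxE !big_ord_recl !big_ord0 /= !addr0.
  have -> : lift (0 : 'I_2) 0 = 1 by apply/val_inj.
  by rewrite u0 v0 u1 v1 !mul0r !mulr0 !add0r addr0 !eqxx.
Qed.

HB.instance Definition _ := GRing.isSubalgClosed.Build F 'M[F]_2 C2_pred
  C2_subalg_closed.

Record C2 := MkC2 { C2_val :> 'M[F]_2; _ : C2_val \in C2_pred }.
HB.instance Definition _ := [isSub for C2_val].
HB.instance Definition _ := [Choice of C2 by <:].
HB.instance Definition _ := [SubChoice_isSubAlgebra of C2 by <:].

Variable e : F.

Definition C2_tr (x : C2) : F := e * (x : 'M[F]_2) 0 0 + (x : 'M[F]_2) 0 1.

Lemma C2_tr_scalar : scalar C2_tr.
Proof.
move=> a x y; rewrite /C2_tr !mxE.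
by rewrite !mulrDr addrACA !mulrA [e * a]mulrC.
Qed.

HB.instance Definition _ := GRing.isLinear.Build F C2 F *%R C2_tr C2_tr_scalar.

Lemma C2_trC (x y : C2) : C2_tr (x * y) = C2_tr (y * x).
Proof.
case: x y => [x xP] [y yP]; congr (_ * _ + _) => /=.
all: move: xP yP; rewrite !inE => /andP[/eqP x0 /eqP x1] /andP[/eqP y0 /eqP y1].
all: rewrite !mxE !big_ord_recl !big_ord0 /= !addr0.
all: have -> : lift (0 : 'I_2) 0 = 1 by apply/val_inj.
  by rewrite x0 y0 !mulr0 !addr0 mulrC.
rewrite x1 y1 addrC; congr (_ + _); exact: mulrC.
Qed.

(* The algebra C_2 with trace t_(e,1). *)
Definition C2_trAlgebra : trAlgebra F := @TrAlgebra F C2 C2_tr C2_trC.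

End C2.

(* Main.v *)
From HB Require Import structures.
Require Import Defs.
From mathcomp Require Import ring zify.
From Stdlib Require Import Classical.

Set Implicit Arguments.
Unset Strict Implicit.
Unset Printing Implicit Defensive.

Import GRing.Theory Num.Theory.
Local Open Scope ring_scope.

(** Write an element of C_2 as [a + b u] with [u ^ 2 = 0], so that its trace is
    [e a + b].  The proof does not look for a classification of the algebras
    in the variety: three explicit trace identities of C_2 are enough.  They are
    commutativity, the cubic identity
      [tr(y) x^3 - 3 tr(xy) x^2 + 3 tr(x^2 y) x - tr(x^3 y) = 0]
    (a third difference: [tr(p(x) y) q(x)] only depends on the class of
    [p(X) q(Y)] modulo [(X - Y)^3]), and the quartic identity
      [4 tr(x) tr(x^3) - 3 tr(x^2)^2 = e tr(x^4)],
    which is the only one to remember the scalar [e].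

    Let B satisfy these identities, with a nonzero trace.  The cubic
    identity forces every element x of B to have a single eigenvalue, and one
    that lies in F: [(x - a)^3 = 0] for some scalar a ([eigenvalue_cube]).
    There are then two cases.

    If some nilpotent j has a nonzero trace, then [j^2 = 0] by the cubic
    identity ([nilpotent_traced_sqr0]); after rescaling, [tr j = 1], and the
    quartic identity gives [tr 1 = e] ([var_C2_tr1]).  The span of 1 and j is
    then a copy of C_2 with its trace, so that every trace identity of B holds in
    C_2 ([C2_embedding]), and the subvariety generated by B is not proper.

    Otherwise all nilpotent elements are traceless.  Then the kernel J of the
    trace satisfies [J^3 = 0] ([tr0_mul3]) and the trace is a scalar multiple
    of an algebra morphism [a : B -> F] ([tr_quasi_mul]).  Writing each
    variable as [a(x) + j(x)] with [j(x)] in J and expanding, every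
    multilinear trace monomial of degree n becomes a combination of the
    products [\prod_(i notin R) a(x_i) \prod_(i in R) j(x_i)] with
    [#|R| <= 2], since the products of three elements of J vanish
    ([scalar_trace_codim]).  There are at most [(n + 1)^2] of these.  When the
    trace of B is zero, commutativity alone bounds the codimensions by 1
    ([trace0_codim]). *)

(** * Dimension of a quotient *)

Section QuotientDimension.
Variables (F : fieldType) (V : lmodType F) (U W : V -> Prop).
Hypothesis (U0 : U 0) (UL : forall a u v, U u -> U v -> U (a *: u + v)).
Hypothesis WZ : forall a u, W u -> W (a *: u).

Definition free_mod d (b : 'I_d -> V) : Prop :=
  (forall i, U (b i)) /\
  forall a : 'I_d -> F,
    U (\sum_i a i *: b i) /\ W (\sum_i a i *: b i) -> forall i, a i = 0.

(** A family of more than N vectors has a nontrivial linear relation after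
    applying [phi], and such a relation holds modulo W. *)
Lemma free_mod_leq N (phi : {linear V -> 'rV[F]_N}) d (b : 'I_d -> V) :
  (forall u, U u -> phi u = 0 -> W u) -> free_mod b -> (d <= N)%N.
Proof.
move=> phiW [Ub bfree]; rewrite leqNgt; apply/negP => ltNd.
pose M := \matrix_(i < d) phi (b i).
have : kermx M != 0.
  rewrite -mxrank_eq0 mxrank_ker subn_eq0 -ltnNge.
  exact: leq_ltn_trans (rank_leq_col M) ltNd.
case/rowV0Pn => a /sub_kermxP aM /negP; apply; apply/eqP/rowP => i.
rewrite mxE; apply: (bfree (a 0)).
have Us : U (\sum_k a 0 k *: b k).
  by apply: (big_rec U) => // k x _ Ux; apply: UL.
split=> //; apply: phiW => //.
rewrite linear_sum /= -[RHS]aM mulmx_sum_row; apply: eq_bigr => k _.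
by rewrite linearZ rowK.
Qed.

(** The dichotomy behind the existence of bases: an element of U that is not a
    combination of [b] modulo W can be appended to [b]. *)
Lemma free_mod_extend d (b : 'I_d -> V) :
  free_mod b ->
  quotient_dim U W d \/ exists b' : 'I_d.+1 -> V, free_mod b'.
Proof.
move=> [Ub bfree]; have [spans|] := classic (forall u, U u ->
  exists a : 'I_d -> F,
    U (u - \sum_i a i *: b i) /\ W (u - \sum_i a i *: b i)).
  by left; exists b; split.
move=> /not_all_ex_not[u nspan]; right.
have {nspan} [Uu nspan] := imply_to_and _ _ nspan.
pose b' (i : 'I_d.+1) := oapp b u (unlift ord0 i).
exists b'; split=> [i|a]; first by rewrite /b'; case: unliftP => [j|] _ /=.
have -> : \sum_i a i *: b' i = a ord0 *: u + \sum_i a (lift ord0 i) *: b i.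
  rewrite big_ord_recl /b' unlift_none; congr (_ + _).
  by apply: eq_bigr => i _; rewrite liftK.
move=> [Us Ws]; have a0 : a ord0 = 0.
  apply/eqP/negPn/negP => a0; apply: nspan.
  exists (fun i => - (a ord0)^-1 * a (lift ord0 i)).
  have -> : u - \sum_i (- (a ord0)^-1 * a (lift ord0 i)) *: b i =
      (a ord0)^-1 *: (a ord0 *: u + \sum_i a (lift ord0 i) *: b i).
    rewrite scalerDr scalerA mulVf // scale1r scaler_sumr -sumrN.
    congr (_ + _); apply: eq_bigr => i _.
    by rewrite mulNr scaleNr opprK scalerA.
  by split; [rewrite -[X in U X]addr0; apply: UL | apply: WZ].
move: Us Ws; rewrite a0 scale0r add0r => Us Ws i.
by case: (unliftP ord0 i) => [j|] -> //; apply: (bfree (a \o lift ord0)).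
Qed.

(** A family that is free modulo W and cannot be extended is a basis, and its
    size is at most N by [free_mod_leq].  All codimensions below are bounded in
    this way, without exhibiting a basis. *)
Lemma quotient_dim_leq N (phi : {linear V -> 'rV[F]_N}) :
    (forall u, U u -> phi u = 0 -> W u) ->
  exists2 d, quotient_dim U W d & (d <= N)%N.
Proof.
move=> phiW.
have ext k d (b : 'I_d -> V) : free_mod b -> (N < d + k)%N ->
    exists2 d', quotient_dim U W d' & (d' <= N)%N.
  elim: k d b => [|k IHk] d b bfree; have ledN := free_mod_leq phiW bfree.
    by rewrite addn0 ltnNge ledN.
  rewrite addnS -addSn => ltN; have [qd|[b' b'free]] := free_mod_extend bfree.
    by exists d.
  exact: IHk b'free ltN.
apply: (ext N.+1 0 (fun=> 0)); last by rewrite add0n.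
by split=> [[]|a _ []].
Qed.

End QuotientDimension.

(** * Evaluation of trace polynomials *)

Lemma malg_combination_linear (F : fieldType) (K : choiceType) (V : lmodType F)
    (h : K -> V) :
  linear (fun f : {malg F[K]} => \sum_(m <- msupp f) f@_m *: h m).
Proof.
move=> a f g; set D := (msupp f `|` msupp g)%fset.
have wide (f' : {malg F[K]}) : (msupp f' `<=` D)%fset ->
    \sum_(m <- msupp f') f'@_m *: h m = \sum_(m <- D) f'@_m *: h m.
  move=> sub; apply: big_fset_incl sub _ => m _ mf.
  by rewrite (mcoeff_outdom mf) scale0r.
have subD : (msupp (a *: f + g) `<=` D)%fset.
  apply: fsubset_trans (msuppD_le _ _) _.
  by apply: fsetUSS; rewrite ?fsubset_refl ?msuppZ_le.
rewrite /= (wide _ subD) (wide f) ?fsubsetUl // (wide g) ?fsubsetUr //.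
rewrite scaler_sumr -big_split; apply: eq_bigr => m _ /=.
by rewrite mcoeffD mcoeffZ scalerDl scalerA.
Qed.

Definition letters (i : nat) (s : seq nat) : word := exist _ (i :: s) isT.

(** The trace monomial [Tr(u_1) ... Tr(u_k) w], for [us = [:: u_1; ...; u_k]].
    It is locked because a comparison of two of its instances by unfolding,
    down to the quotient of words by rotation, is prohibitively long. *)
HB.lock Definition trword (F : fieldType) (us : seq word) (w : seq nat) :
    freeTr F :=
  << (\big[@mmul {cmonom cycword}/mone]_(u <- us) ucm (\pi_cycword u)%qT,
      FMonom w) >>.

Section Evaluation.
Variable F : fieldType.
Implicit Types (A B : trAlgebra F) (f : freeTr F).

Lemma tr_evalE A (v : nat -> A) f :
  tr_eval v f = \sum_(m <- msupp f) f@_m *: trmonom_eval v m.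
Proof. by rewrite /tr_eval mmapE; apply: eq_bigr => m _; rewrite mulr_algl. Qed.

Lemma tr_eval_linear A (v : nat -> A) : linear (tr_eval v).
Proof. by move=> a f g; rewrite !tr_evalE; apply: malg_combination_linear. Qed.

HB.instance Definition _ A (v : nat -> A) :=
  GRing.isLinear.Build F (freeTr F) A *:%R (tr_eval v) (tr_eval_linear v).

Lemma tr_evalD A (v : nat -> A) f g :
  tr_eval v (f + g) = tr_eval v f + tr_eval v g.
Proof. exact: linearD. Qed.

Lemma tr_evalN A (v : nat -> A) f : tr_eval v (- f) = - tr_eval v f.
Proof. exact: linearN. Qed.

Lemma tr_evalZ A (v : nat -> A) a f : tr_eval v (a *: f) = a *: tr_eval v f.
Proof. exact: linearZZ. Qed.

Definition cmonom_eval (R : comPzRingType) (I : choiceType) (h : I -> R)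
    (m : {cmonom I}) : R :=
  \prod_(c <- finsupp m) h c ^+ m c.

Lemma cmonom_eval1 (R : comPzRingType) (I : choiceType) (h : I -> R) :
  cmonom_eval h mone = 1.
Proof. by rewrite /cmonom_eval mdom1 big_seq_fset0. Qed.

Lemma cmonom_evalU (R : comPzRingType) (I : choiceType) (h : I -> R) c :
  cmonom_eval h (ucm c) = h c.
Proof. by rewrite /cmonom_eval mdomU big_seq_fset1 cmUU expr1. Qed.

Lemma cmonom_evalM (R : comPzRingType) (I : choiceType) (h : I -> R) :
  {morph cmonom_eval h : m1 m2 / mmul m1 m2 >-> m1 * m2}.
Proof.
move=> m1 m2; rewrite /cmonom_eval.
have wide (m : {cmonom I}) : (finsupp m `<=` finsupp (mmul m1 m2))%fset ->
    \prod_(c <- finsupp m) h c ^+ m c =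
    \prod_(c <- finsupp (mmul m1 m2)) h c ^+ m c.
  move=> sub; apply: big_fset_incl sub _ => c _ cm.
  by have /eqP -> : m c == 0%N by rewrite cmE_eq0.
rewrite (wide m1) ?mdomD ?fsubsetUl // (wide m2) ?mdomD ?fsubsetUr //.
by rewrite -big_split; apply: eq_bigr => c _ /=; rewrite cmM exprD.
Qed.

Lemma tr_eval_trword A (v : nat -> A) us w :
  tr_eval v (trword F us w) =
  (\prod_(u <- us) tr (word_eval v (val u))) *: word_eval v w.
Proof.
rewrite trword.unlock /tr_eval mmapU /= scale1r mul1r; congr (_ *: _) => /=.
pose h c := tr (word_eval v (cycword_seq c)).
rewrite -[LHS]/(cmonom_eval h _).
rewrite (big_morph _ (cmonom_evalM h) (cmonom_eval1 h)).
by apply: eq_bigr => u _; rewrite cmonom_evalU; apply: tr_word_eval_pi.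
Qed.

Lemma tr_eval_morph A B (phi : A -> B) (v : nat -> A) f :
    linear phi -> phi 1 = 1 -> {morph phi : x y / x * y} ->
    (forall x, tr (phi x) = tr x) ->
  tr_eval (phi \o v) f = phi (tr_eval v f).
Proof.
move=> phiL phi1 phiM phit.
pose lphi : {linear A -> B} :=
  HB.pack phi (GRing.isLinear.Build F A B *:%R phi phiL).
have word_phi w : word_eval (phi \o v) w = phi (word_eval v w).
  by rewrite /word_eval (big_morph phi phiM phi1).
have phiZ a x : phi (a *: x) = a *: phi x by exact: (linearZZ lphi).
rewrite !tr_evalE -[RHS]/(lphi _) linear_sum; apply: eq_bigr => m _ /=.
rewrite !phiZ -word_phi; congr (_ *: (_ *: _)).
by apply: eq_bigr => c _; rewrite word_phi phit.
Qed.

End Evaluation.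

(** * The algebra C_2 in coordinates *)

Section C2Coordinates.
Variables (F : fieldType) (e : F).
Local Notation C2 := (C2 F).
Implicit Types x y : C2.

Definition C2_diag x : F := (x : 'M[F]_2) 0 0.
Definition C2_nil x : F := (x : 'M[F]_2) 0 1.

Lemma C2_eqP x y : C2_diag x = C2_diag y -> C2_nil x = C2_nil y -> x = y.
Proof.
case: x y => [x xP] [y yP]; rewrite /C2_diag /C2_nil /= => e00 e01.
apply/val_inj/matrixP => i j /=.
move: xP yP; rewrite !inE => /andP[/eqP x0 /eqP x1] /andP[/eqP y0 /eqP y1].
have o0 k : Ordinal (k : (0 < 2)%N) = 0 :> 'I_2 by exact/val_inj.
have o1 k : Ordinal (k : (1 < 2)%N) = 1 :> 'I_2 by exact/val_inj.
case: i j => [[|[|//]] ilt] [[|[|//]] jlt].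
- by rewrite (o0 ilt) (o0 jlt).
- by rewrite (o0 ilt) (o1 jlt).
- by rewrite (o1 ilt) (o0 jlt) x0 y0.
- by rewrite (o1 ilt) (o1 jlt) -x1 -y1.
Qed.

Lemma C2_diag_linear : scalar C2_diag.
Proof. by move=> a x y; rewrite /C2_diag !mxE. Qed.

Lemma C2_nil_linear : scalar C2_nil.
Proof. by move=> a x y; rewrite /C2_nil !mxE. Qed.

HB.instance Definition _ :=
  GRing.isLinear.Build F C2 F *%R C2_diag C2_diag_linear.
HB.instance Definition _ :=
  GRing.isLinear.Build F C2 F *%R C2_nil C2_nil_linear.

Lemma C2_diag1 : C2_diag 1 = 1.
Proof. by rewrite /C2_diag mxE. Qed.

Lemma C2_nil1 : C2_nil 1 = 0.
Proof. by rewrite /C2_nil mxE. Qed.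

Lemma C2_diagM x y : C2_diag (x * y) = C2_diag x * C2_diag y.
Proof.
case: x y => [x xP] [y yP]; rewrite /C2_diag /=.
move: xP yP; rewrite !inE => /andP[/eqP x0 /eqP x1] /andP[/eqP y0 /eqP y1].
rewrite !mxE !big_ord_recl big_ord0 /= addr0.
have -> : lift (0 : 'I_2) 0 = 1 by apply/val_inj.
by rewrite y0 mulr0 addr0.
Qed.

Lemma C2_nilM x y :
  C2_nil (x * y) = C2_diag x * C2_nil y + C2_nil x * C2_diag y.
Proof.
case: x y => [x xP] [y yP]; rewrite /C2_diag /C2_nil /=.
move: xP yP; rewrite !inE => /andP[/eqP x0 /eqP x1] /andP[/eqP y0 /eqP y1].
rewrite !mxE !big_ord_recl big_ord0 /= addr0.
have -> : lift (0 : 'I_2) 0 = 1 by apply/val_inj.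
by rewrite y1.
Qed.

Lemma C2_trE (x : C2_trAlgebra e) : tr x = e * C2_diag x + C2_nil x.
Proof. by []. Qed.

(** The elements 1 and j span a copy of C_2 in B with the same trace, and trace
    identities pass to subalgebras. *)
Lemma C2_embedding (B : trAlgebra F) (j : B) f :
    j ^+ 2 = 0 -> tr j = 1 -> tr (1 : B) = e ->
  trace_identity B f -> trace_identity (C2_trAlgebra e) f.
Proof.
move=> j2 tj t1 Bf v.
pose phi (x : C2_trAlgebra e) : B := C2_diag x *: 1 + C2_nil x *: j.
have phiL : linear phi.
  move=> a x y; rewrite /phi C2_diag_linear C2_nil_linear !scalerDl scalerDr.
  by rewrite !scalerA addrACA.
have phi1 : phi 1 = 1.
  by rewrite /phi C2_diag1 C2_nil1 scale1r scale0r addr0.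
have phiM : {morph phi : x y / x * y}.
  move=> x y; rewrite /phi C2_diagM C2_nilM mulrDl !mulrDr.
  rewrite -!scalerAl -!scalerAr !mulr1 mul1r -expr2 j2 !scaler0 addr0.
  by rewrite !scalerA scalerDl addrA.
have phit (x : C2_trAlgebra e) : tr (phi x) = tr x.
  by rewrite linearD !linearZ /= tj t1 mulr1 mulrC C2_trE.
have := Bf (phi \o v); rewrite tr_eval_morph // => phi0.
set z := tr_eval v f in phi0 *; clearbody z.
have diag0 : C2_diag z = 0.
  (* Multiplying by j kills the nilpotent part, since j ^+ 2 = 0. *)
  have := congr1 (fun b : B => tr (b * j)) phi0.
  by rewrite mulrDl -!scalerAl mul1r -expr2 j2 scaler0 addr0 mul0r linear0
             linearZ /= tj mulr1.
apply: C2_eqP; rewrite ?diag0 linear0 //.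
have := congr1 (@tr _ B) phi0.
by rewrite /phi diag0 scale0r add0r linear0 linearZ /= tj mulr1.
Qed.

End C2Coordinates.

(** * Three trace identities of C_2 *)

Section C2Identities.
Variables (F : fieldType) (e : F).
Local Notation x := 0%N.
Local Notation y := 1%N.

Definition commutator_poly : freeTr F :=
  trword F [::] [:: x; y] - trword F [::] [:: y; x].

Definition cubic_poly : freeTr F :=
  trword F [:: letters y [::]] [:: x; x; x]
  - 3%:R *: trword F [:: letters x [:: y]] [:: x; x]
  + 3%:R *: trword F [:: letters x [:: x; y]] [:: x]
  - trword F [:: letters x [:: x; x; y]] [::].

Definition quartic_poly : freeTr F :=
  4%:R *: trword F [:: letters x [::]; letters x [:: x; x]] [::]
  - 3%:R *: trword F [:: letters x [:: x]; letters x [:: x]] [::]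
  - e *: trword F [:: letters x [:: x; x; x]] [::].

Definition tr_evalS := (tr_evalD, tr_evalN, tr_evalZ, tr_eval_trword).

Lemma tr_eval_commutator (B : trAlgebra F) (v : nat -> B) :
  tr_eval v commutator_poly = v x * v y - v y * v x.
Proof.
rewrite /commutator_poly !tr_evalS !big_nil !scale1r.
by rewrite /word_eval !big_cons !big_nil !mulr1.
Qed.

Lemma tr_eval_cubic (B : trAlgebra F) (v : nat -> B) :
  tr_eval v cubic_poly =
  tr (v y) *: v x ^+ 3 - (3 * tr (v x * v y)) *: v x ^+ 2
    + (3 * tr (v x ^+ 2 * v y)) *: v x - tr (v x ^+ 3 * v y) *: 1.
Proof.
rewrite /cubic_poly !tr_evalS /word_eval !big_cons !big_nil !mulr1 !scalerA.
by rewrite !exprS expr0 !mulr1 !mulrA.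
Qed.

Lemma tr_eval_quartic (B : trAlgebra F) (v : nat -> B) :
  tr_eval v quartic_poly =
  (4 * (tr (v x) * tr (v x ^+ 3)) - 3 * tr (v x ^+ 2) ^+ 2
    - e * tr (v x ^+ 4)) *: 1.
Proof.
rewrite /quartic_poly !tr_evalS /word_eval !big_cons !big_nil !mulr1 !scalerA.
by rewrite !scalerBl !exprS expr0 !mulr1 !mulrA.
Qed.

Lemma C2_commutator : trace_identity (C2_trAlgebra e) commutator_poly.
Proof.
move=> v; rewrite tr_eval_commutator; apply/eqP; rewrite subr_eq0; apply/eqP.
by apply: C2_eqP; rewrite ?C2_diagM ?C2_nilM; ring.
Qed.

Definition C2E := (C2_trE, C2_diagM, C2_nilM, C2_diag1, C2_nil1).

Lemma C2_cubic : trace_identity (C2_trAlgebra e) cubic_poly.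
Proof.
move=> v; rewrite tr_eval_cubic.
apply: C2_eqP; rewrite linear0 !(linearB, linearD, linearZ) /=.
all: by rewrite !exprS expr0 !C2E; ring.
Qed.

Lemma C2_quartic : trace_identity (C2_trAlgebra e) quartic_poly.
Proof.
move=> v; rewrite tr_eval_quartic -[RHS](scale0r 1); congr (_ *: _).
by rewrite !exprS expr0 !C2E; ring.
Qed.

Variable B : trAlgebra F.
Hypothesis BC2 : var_tr (C2_trAlgebra e) B.

Lemma var_C2_commutative (a b : B) : a * b = b * a.
Proof.
have /(_ (nth 0 [:: a; b])) := BC2 C2_commutator.
by rewrite tr_eval_commutator => /eqP; rewrite subr_eq0 => /eqP.
Qed.

Lemma var_C2_cubic (a b : B) :
  tr b *: a ^+ 3 - (3 * tr (a * b)) *: a ^+ 2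
    + (3 * tr (a ^+ 2 * b)) *: a - tr (a ^+ 3 * b) *: 1 = 0.
Proof.
by have /(_ (nth 0 [:: a; b])) := BC2 C2_cubic; rewrite tr_eval_cubic.
Qed.

Lemma var_C2_quartic (a : B) :
  4 * (tr a * tr (a ^+ 3)) - 3 * tr (a ^+ 2) ^+ 2 = e * tr (a ^+ 4).
Proof.
have /(_ (fun=> a)) := BC2 C2_quartic; rewrite tr_eval_quartic => /eqP.
by rewrite scaler_eq0 oner_eq0 orbF subr_eq0 => /eqP.
Qed.

(** Taking [x = 1] and [x = 1 + j] in the quartic identity, with [u = tr 1],
    gives [u^2 = e u] and [u^2 + 4 u = e (u + 4)]. *)
Lemma var_C2_tr1 (j : B) :
  [pchar F] =i pred0 -> j ^+ 2 = 0 -> tr j = 1 -> tr (1 : B) = e.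
Proof.
move=> F0 j2 tj; pose u := tr (1 : B).
have pow k : (1 + j) ^+ k = 1 + j *+ k.
  elim: k => [|k IHk]; first by rewrite expr0 addr0.
  rewrite exprS IHk mulrDl mul1r mulrDr mulr1 mulrnAr -expr2 j2 mul0rn addr0.
  by rewrite mulrSr addrA.
have trpow k : tr ((1 + j) ^+ k) = u + k%:R.
  by rewrite pow linearD linearMn /= tj.
have := var_C2_quartic 1; rewrite !expr1n -/u => E0.
have := var_C2_quartic (1 + j).
rewrite !trpow -[X in tr X](expr1 (1 + j)) trpow => E1.
have : 4%:R * (u - e) = 0.
  transitivity (4 * ((u + 1%:R) * (u + 3%:R)) - 3 * (u + 2%:R) ^+ 2
     - e * (u + 4%:R) - (4 * (u * u) - 3 * u ^+ 2 - e * u)); first by ring.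
  by rewrite E0 E1 !subrr.
move/eqP; rewrite mulf_eq0 subr_eq0; have /charf0P -> /= := F0.
by move/eqP.
Qed.

End C2Identities.

(** * Commutative algebras with trace satisfying the cubic identity *)

Section Structure.
Variables (F : fieldType) (A : comAlgType F) (t : {scalar A}).
Hypothesis F_char0 : [pchar F] =i pred0.
Hypothesis cubic : forall x y : A,
  t y *: x ^+ 3 - (3 * t (x * y)) *: x ^+ 2
    + (3 * t (x ^+ 2 * y)) *: x - t (x ^+ 3 * y) *: 1 = 0.

Lemma char0_neq0 n : n.+1%:R != 0 :> F.
Proof. by have /charf0P -> := F_char0. Qed.

Let scalerE (a : F) (x : A) : a *: x = in_alg A a * x.
Proof. by rewrite mulr_algl. Qed.

(** The cubic identity is invariant under [x |-> x + c], so x may be replaced by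
    [z = x - tr(x y)], for which [tr(z y) = 0].  Put [p = tr(z^2 y)] and
    [r = tr(z^3 y)].  The identity for [(z, y)] and for [(z, z y)] reads
    [z^3 = r - 3 p z] and [p z^2 = r z + p^2].  If [p = 0], this gives
    [r = 0] and [z^3 = 0].  If not, z satisfies a quadratic equation, and
    reducing [z^3] in two ways shows that its discriminant is zero. *)
Lemma eigenvalue_cube y (x : A) : t y = 1 -> exists a : F, (x - a%:A) ^+ 3 = 0.
Proof.
move=> ty.
pose z := x - (t (x * y))%:A.
have tz : t (z * y) = 0.
  by rewrite /z mulrBl mulr_algl linearB linearZ /= ty mulr1 subrr.
have xz b : x - (t (x * y) + b)%:A = z - b%:A by rewrite scalerDl opprD addrA.
set p := t (z ^+ 2 * y); set r := t (z ^+ 3 * y).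
have E1 : z ^+ 3 = r *: 1 - (3 * p) *: z.
  have := cubic z y; rewrite ty tz mulr0 scale0r subr0 scale1r -/p -/r.
  by move/eqP; rewrite subr_eq0 => /eqP <-; rewrite addrK.
have E2 : p *: z ^+ 2 = r *: z + p *: (p *: 1).
  have := cubic z (z * y).
  rewrite !mulrA -!exprSr -expr2 tz scale0r sub0r -/p -/r.
  have -> : t (z ^+ 4 * y) = - (3 * p ^+ 2).
    rewrite exprSr E1 -mulrA mulrBl -!scalerAl mul1r mulrA -expr2.
    by rewrite linearB !linearZ /= tz -/p mulr0 sub0r expr2 mulrA.
  rewrite -!scalerA scaleNr opprK -scalerA -scalerN -!scalerDr => /eqP.
  rewrite scaler_eq0 (negPf (char0_neq0 2)) /=.
  by rewrite scalerA -addrA addrC subr_eq0 => /eqP <-.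
have [p0|p0] := eqVneq p 0.
  have r0 : r = 0.
    apply/eqP/negPn/negP => rn0; move: E2 => /esym/eqP.
    rewrite p0 !scale0r addr0 scaler_eq0 (negPf rn0) /= => /eqP z0.
    by move: rn0; rewrite /r z0 expr0n mul0r linear0 eqxx.
  by exists (t (x * y)); rewrite -/z E1 r0 p0 mulr0 !scale0r subr0.
pose q := r / (2 * p).
have rE : r = 2 * p * q.
  by rewrite /q mulrC divfK // mulf_neq0 ?char0_neq0.
have E3 : z ^+ 2 = in_alg A (2 * q) * z + in_alg A p.
  apply: (scalerI p0); rewrite E2 rE !scalerE; ring.
have z0 : z != 0.
  by apply: contra_neq p0 => z0; rewrite /p z0 expr0n mul0r linear0.
have disc : q ^+ 2 + p = 0.
  have : (4 * (q ^+ 2 + p)) *: z = 0.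
    have : z * z ^+ 2 = r *: 1 - (3 * p) *: z by rewrite -exprS.
    rewrite E3 mulrDr mulrCA -expr2 E3 rE !scalerE.
    move/eqP; rewrite -subr_eq0 => /eqP e; rewrite -[RHS]e; ring.
  move/eqP; rewrite scaler_eq0 (negPf z0) orbF mulf_eq0.
  by rewrite (negPf (char0_neq0 3)) => /eqP.
exists (t (x * y) + q); rewrite xz.
have -> : (z - q%:A) ^+ 3 = (z - in_alg A q) * (z - in_alg A q) ^+ 2.
  by rewrite -exprS.
have -> : (z - in_alg A q) ^+ 2 = in_alg A (q ^+ 2 + p).
  by rewrite sqrrB E3; ring.
by rewrite disc rmorph0 mulr0.
Qed.

(** The cubic identity for [(j, 1)] is [tr(j^2) j = tr(j) j^2]; multiply it
    by j. *)
Lemma nilpotent_traced_sqr0 (j : A) : j ^+ 3 = 0 -> t j != 0 -> j ^+ 2 = 0.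
Proof.
move=> j3 tj.
have E : t (j ^+ 2) *: j = t j *: j ^+ 2.
  have := cubic j 1; rewrite !mulr1 j3 scaler0 linear0 scale0r subr0 sub0r.
  rewrite -!scalerA addrC -scalerBr => /eqP.
  by rewrite scaler_eq0 (negPf (char0_neq0 2)) subr_eq0 => /eqP.
have := congr1 ( *%R j) E.
rewrite -!scalerAr -expr2 -exprS j3 scaler0 => /eqP.
rewrite scaler_eq0 => /orP[/eqP t2|/eqP //].
move: E; rewrite t2 scale0r => /esym/eqP.
by rewrite scaler_eq0 (negPf tj) => /eqP.
Qed.

Hypothesis nil_tr0 : forall j : A, j ^+ 3 = 0 -> t j = 0.
Variable y0 : A.
Hypothesis ty0 : t y0 = 1.

Lemma tr1_neq0 : t 1 != 0.
Proof.
apply/eqP => t1; have [a /nil_tr0] := eigenvalue_cube y0 ty0.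
rewrite linearB linearZ /= t1 mulr0 subr0 ty0 => /eqP.
by rewrite oner_eq0.
Qed.

Lemma tr0_cube0 (x : A) : t x = 0 -> x ^+ 3 = 0.
Proof.
move=> tx; have [a xa] := eigenvalue_cube x ty0; have := nil_tr0 xa.
rewrite linearB linearZ /= tx sub0r => /eqP.
rewrite oppr_eq0 mulf_eq0 (negPf tr1_neq0) orbF => /eqP a0.
by rewrite -xa a0 scale0r subr0.
Qed.

(** Traceless elements have cube zero by [tr0_cube0], and they form a subspace,
    so this is the polarization of [x^3 = 0]. *)
Lemma tr0_mul3 (x y z : A) : t x = 0 -> t y = 0 -> t z = 0 -> x * y * z = 0.
Proof.
move=> tx ty tz.
have : (6%:R : F) *: (x * y * z) = 0.
  transitivity ((x + y + z) ^+ 3 - (x + y) ^+ 3 - (x + z) ^+ 3 - (y + z) ^+ 3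
                + x ^+ 3 + y ^+ 3 + z ^+ 3).
    by rewrite scaler_nat; ring.
  by rewrite !tr0_cube0 ?linearD /= ?tx ?ty ?tz ?addr0 ?subr0.
by move/eqP; rewrite scaler_eq0 (negPf (char0_neq0 5)) => /eqP.
Qed.

(** The element [x y] has a scalar part a and a traceless part; the product of
    the latter with [x y] vanishes by [tr0_mul3], as does the square of [x y],
    whence [a (x y) = 0]. *)
Lemma tr0_mul2 (x y : A) : t x = 0 -> t y = 0 -> t (x * y) = 0.
Proof.
move=> tx ty; have [a xya] := eigenvalue_cube (x * y) ty0.
have tl := nil_tr0 xya; set l := x * y - a%:A in tl.
have : a *: (x * y) = 0.
  have := tr0_mul3 tx ty tl; rewrite /l mulrBr mulr_algr (mulrA (x * y)).
  rewrite (tr0_mul3 tx ty tx) mul0r sub0r.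
  by move/eqP; rewrite oppr_eq0 => /eqP.
move/eqP; rewrite scaler_eq0 => /orP[/eqP a0|/eqP -> ]; last exact: linear0.
by move: tl; rewrite /l a0 scale0r subr0.
Qed.

(** In other words [x |-> tr x / tr 1] is multiplicative. *)
Lemma tr_quasi_mul (x y : A) : t 1 * t (x * y) = t x * t y.
Proof.
have t1 := tr1_neq0.
have part (z : A) : exists2 j, z = (t z / t 1)%:A + j & t j = 0.
  exists (z - (t z / t 1)%:A); first by rewrite addrC subrK.
  by rewrite linearB linearZ /= divfK // subrr.
have [j xE tj] := part x; have [k yE tk] := part y.
rewrite {1}xE {1}yE mulrDl !mulrDr mulr_algl mulr_algr mulr_algl.
rewrite !linearD !linearZ /= tj tk tr0_mul2 //; field.
exact: t1.
Qed.

End Structure.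

(** * Codimensions *)

Section Codimension.
Variables (F : fieldType) (B : trAlgebra F).

(** If the evaluations of the multilinear trace monomials of degree n are all
    combinations of [#|S|] fixed functions of the variables, the coefficients
    of these combinations define the linear map of [quotient_dim_leq]. *)
Lemma trace_codim_leq n (T : finType) (S : {set T})
    (g : T -> (nat -> B) -> B) (c : T -> trmonom -> F) :
    (forall m, multilinear_trmonom n m -> forall v : nat -> B,
       trmonom_eval v m = \sum_(t in S) c t m *: g t v) ->
  exists2 d, trace_codim B n d & (d <= #|S|)%N.
Proof.
move=> evalE.
pose phi (f : freeTr F) : 'rV[F]_#|S| :=
  \sum_(m <- msupp f) f@_m *: \row_k c (enum_val k) m.
have phi_linear : linear phi by exact: malg_combination_linear.
pose lphi : {linear freeTr F -> 'rV[F]_#|S|} :=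
  HB.pack phi (GRing.isLinear.Build F _ _ *:%R phi phi_linear).
apply: (@quotient_dim_leq _ _ _ _ _ _ _ _ lphi).
- by move=> m; rewrite msupp0.
- move=> a f h fn hn m /(fsubsetP (msuppD_le _ _)); rewrite in_fsetU.
  by move=> /orP[/(fsubsetP (msuppZ_le _ _))|]; [apply: fn | apply: hn].
- by move=> a f Bf v; rewrite tr_evalZ Bf scaler0.
move=> f fn phi0 v; rewrite tr_evalE.
rewrite (eq_big_seq (fun m => \sum_(t in S) (f@_m * c t m) *: g t v)).
  rewrite exchange_big big1 // => t tS /=; rewrite -scaler_suml.
  have := congr1 (fun r : 'rV_#|S| => r 0 (enum_rank_in tS t)) phi0.
  rewrite /= /phi summxE mxE => c0.
  suff -> : \sum_(m <- msupp f) f@_m * c t m = 0 by rewrite scale0r.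
  by rewrite -[RHS]c0; apply: eq_bigr => m _; rewrite !mxE enum_rankK_in.
move=> m mf; rewrite /= (evalE m (fn m mf)) scaler_sumr.
by apply: eq_bigr => t _; rewrite scalerA.
Qed.

Lemma polynomial_growth_sqr :
    (forall n, exists2 d, trace_codim B n d & (d <= n.+1 ^ 2)%N) ->
  polynomial_growth B.
Proof.
move=> codim; exists (('X + 1%:P) ^+ 2) => n; have [d cd led] := codim n.
exists d => //.
by rewrite horner_exp hornerD hornerX hornerC natr1 -natrX ler_nat.
Qed.

End Codimension.

Lemma card_small_sets n :
  (#|[set J : {set 'I_n} | (#|J| <= 2)%N]| <= n.+1 ^ 2)%N.
Proof.
have -> : [set J : {set 'I_n} | (#|J| <= 2)%N] =
    [set J : {set 'I_n} | #|J| == 0%N] :|: [set J : {set 'I_n} | #|J| == 1%N]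
      :|: [set J : {set 'I_n} | #|J| == 2%N].
  by apply/setP => J; rewrite !inE; case: #|J| => [|[|[|]]].
apply: leq_trans (leq_card_setU _ _) _.
apply: leq_trans (leq_add (leq_card_setU _ _) (leqnn _)) _.
rewrite !card_draws card_ord bin0 bin1 bin2.
have := half_leq (leq_mul (leqnn n) (leq_pred n)); nia.
Qed.

Lemma prod_seq_count (R : comPzRingType) n (s : seq nat) (h : nat -> R) :
  all (gtn n) s ->
  \prod_(i <- s) h i = \prod_(i < n) h i ^+ count_mem (i : nat) s.
Proof.
elim: s => [_|k s IHs /andP[/= ltkn /IHs E]].
  by rewrite big_nil big1 // => i _; rewrite expr0.
rewrite big_cons E (bigD1 (Ordinal ltkn)) //= [RHS](bigD1 (Ordinal ltkn)) //=.
rewrite eqxx exprS mulrA; congr (_ * _); apply: eq_bigr => i.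
by rewrite -val_eqE /= eq_sym => /negPf ->.
Qed.

Lemma all_gtn_count n (s : seq nat) :
  (forall i, (n <= i)%N -> count_mem i s = 0%N) -> all (gtn n) s.
Proof.
move=> s0; apply/allP => i si; rewrite /= ltnNge; apply/negP => /s0 /eqP.
by rewrite -leqn0 leqNgt -has_count has_pred1 si.
Qed.

Section CommutativeCount.
Variables (F : fieldType) (A : comAlgType F) (t : {scalar A}).
Hypothesis tC : forall a b : A, t (a * b) = t (b * a).
Let B : trAlgebra F := @TrAlgebra F A t tC.

Section Multilinear.
Variables (n : nat) (m : trmonom).
Hypothesis mn : multilinear_trmonom n m.

Lemma multilinear_word : all (gtn n) (m.2 : seq nat).
Proof.
apply: all_gtn_count => i ni; have := mn i; rewrite ltnNge ni /= => /eqP.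
by rewrite addn_eq0 => /andP[_ /eqP].
Qed.

Lemma multilinear_cycword c : c \in finsupp m.1 -> all (gtn n) (cycword_seq c).
Proof.
move=> cm; apply: all_gtn_count => i ni; have := mn i.
rewrite ltnNge ni /= => /eqP; rewrite addn_eq0 (big_fsetD1 c) //= addn_eq0.
by rewrite muln_eq0 cmE_eq0 cm => /andP[/andP[/eqP]].
Qed.

(** If the trace is [e] times a morphism [a], a product of traces of words only
    remembers the number of traces and the letters that occur in them; these are
    the letters of [x_0 ... x_(n-1)] missing from the word part of m. *)
Lemma multilinear_trace_part (a : A -> F) (e : F) (v : nat -> A) :
    a 1 = 1 -> {morph a : x y / x * y} -> (forall x, t x = e * a x) ->
  \prod_(c <- finsupp m.1)
    tr (word_eval (v : nat -> B) (cycword_seq c)) ^+ m.1 c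
  = e ^+ mdeg m.1 *
    \prod_(i < n) a (v i) ^+ ((i < n) - count_mem (i : nat) (m.2 : seq nat)).
Proof.
move=> a1 aM tE.
rewrite (eq_big_seq (fun c => e ^+ m.1 c *
    \prod_(i < n) a (v i) ^+ (m.1 c * count_mem (i : nat) (cycword_seq c)))).
  rewrite big_split prodrXr -mdegE /=; congr (_ * _).
  rewrite exchange_big; apply: eq_bigr => i _ /=.
  by rewrite prodrXr -mn addnK.
move=> c cm /=; rewrite (tE : forall x : B, tr x = e * a x).
rewrite /word_eval (big_morph a aM a1).
rewrite (prod_seq_count (a \o v) (multilinear_cycword cm)) exprMn -prodrXl.
by congr (_ * _); apply: eq_bigr => i _; rewrite -exprM mulnC.
Qed.

End Multilinear.

Lemma word_eval_multilinear n m (v : nat -> A) : multilinear_trmonom n m ->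
  word_eval (v : nat -> B) m.2 =
  \prod_(i < n) v i ^+ count_mem (i : nat) (m.2 : seq nat).
Proof.
by move=> /multilinear_word ltn; rewrite /word_eval (prod_seq_count v ltn).
Qed.

(** Only the monomials without traces survive, and by commutativity they all
    have the value [\prod_(i < n) v i]. *)
Lemma trace0_codim n : (forall x, t x = 0) ->
  exists2 d, trace_codim B n d & (d <= n.+1 ^ 2)%N.
Proof.
move=> t0.
pose c (u : unit) (m : trmonom) : F := (m.1 == mone)%:R.
pose g (u : unit) (v : nat -> A) : A := \prod_(i < n) v i.
have [m mn v|d cd led] := @trace_codim_leq F B n unit setT g c; last first.
  by exists d => //; apply: leq_trans led _; rewrite cardsT card_unit expn_gt0.
rewrite (big_pred1 tt) => [|[]]; last by rewrite inE.
rewrite /trmonom_eval (word_eval_multilinear _ mn) /c /g.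
have [m1|] := eqVneq m.1 mone.
  rewrite m1 mdom1 big_seq_fset0; congr (_ *: _); apply: eq_bigr => i _.
  have := mn i; rewrite /trmonom_count m1 mdom1 big_seq_fset0 add0n => ->.
  by rewrite ltn_ord expr1.
rewrite -mdeg_eq0 mdegE; case: (fset_0Vmem (finsupp m.1)) => [->|[c0 cm]].
  by rewrite big_seq_fset0.
move=> _; rewrite (big_fsetD1 c0) //= t0 expr0n; have := cm; rewrite -cmE_neq0.
by move/negPf ->; rewrite mul0r !scale0r.
Qed.

(** The letter [x_i] of a multilinear monomial contributes [a (v i)] if it
    occurs in a trace, and [v i = a (v i) + j (v i)] if it occurs in the word
    part, hence [a (v i) + k * j (v i)] in both cases, where [k] is the number
    of its occurrences in the word.  The product of these sums is expanded over
    the sets J of letters from which the term [j (v i)] is chosen; the terms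
    with [#|J| > 2] vanish. *)
Lemma scalar_trace_codim n (a : A -> F) (e : F) :
    a 1 = 1 -> {morph a : x y / x * y} -> (forall x, t x = e * a x) ->
    (forall x y z, (x - (a x)%:A) * (y - (a y)%:A) * (z - (a z)%:A) = 0) ->
  exists2 d, trace_codim B n d & (d <= n.+1 ^ 2)%N.
Proof.
move=> a1 aM tE J3.
pose j x := x - (a x)%:A.
pose c (J : {set 'I_n}) (m : trmonom) : F :=
  e ^+ mdeg m.1 * \prod_(i in J) (count_mem (i : nat) (m.2 : seq nat))%:R.
pose g (J : {set 'I_n}) (v : nat -> A) : A :=
  \prod_(i < n) if i \in J then j (v i) else (a (v i))%:A.
have [m mn v|d cd led] :=
    @trace_codim_leq F B n _ [set J : {set 'I_n} | (#|J| <= 2)%N] g c;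
  last first.
  by exists d => //; apply: leq_trans led (card_small_sets n).
transitivity (\sum_(J : {set 'I_n}) c J m *: g J v); last first.
  rewrite (bigID (mem [set J : {set 'I_n} | (#|J| <= 2)%N])) /=.
  rewrite [X in _ + X]big1 ?addr0 // => J; rewrite inE -ltnNge => /card_gt2P.
  move=> [i1 [i2 [i3 [[J1 J2 J3'] [n12 n23 n31]]]]].
  rewrite /g (bigD1 i1) //= (bigD1 i2) ?[i2 == _]eq_sym //=.
  rewrite (bigD1 i3) /= ?n31 1?eq_sym ?n23 //.
  by rewrite J1 J2 J3' mulrA mulrA J3 mul0r scaler0.
rewrite /trmonom_eval (multilinear_trace_part mn _ a1 aM tE).
rewrite (word_eval_multilinear _ mn).
under [RHS]eq_bigr do rewrite /c -scalerA.
rewrite -scaler_sumr -scalerA; congr (_ *: _).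
transitivity (\prod_(i < n) ((a (v i))%:A
    + (count_mem (i : nat) (m.2 : seq nat))%:R *: j (v i))).
  rewrite -mulr_algl -/(in_alg A _) rmorph_prod -big_split.
  apply: eq_bigr => i _.
  have : (count_mem (i : nat) (m.2 : seq nat) <= (i < n))%N.
    by rewrite -(mn i) leq_addl.
  rewrite ltn_ord.
  case: (count_mem _ _) => [|[|//]] _ /=.
    by rewrite subn0 scale0r addr0 mulr1.
  by rewrite subnn scale1r mul1r scale1r /j addrC subrK.
under eq_bigr do rewrite addrC.
rewrite bigA_distr; apply: eq_bigr => J _.
rewrite /g [X in X *: _]big_mkcond -mulr_algl -/(in_alg A _) rmorph_prod.
rewrite -big_split /=.
apply: eq_bigr => i _; case: ifP => _; first by rewrite /= mulr_algl.
by rewrite scale1r mul1r.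
Qed.

End CommutativeCount.

(** * Growth of the proper subvarieties *)

(** A proof of commutativity turns an algebra into an instance of [comAlgType]
    with the same operations; destructing S exposes its operations, so that
    the two structures agree by computation. *)
Lemma commutative_comAlgType (F : fieldType) (S : algType F) :
  commutative (@GRing.mul S) -> exists A : comAlgType F, A = S :> algType F.
Proof.
move=> mC; pose A : comAlgType F := HB.pack (GRing.Algebra.sort S)
  (GRing.PzSemiRing_hasCommutativeMul.Build S mC).
by exists A; rewrite /A; case: S {A} mC => S [].
Qed.

(** The hypothesis on j excludes a copy of C_2 in A: it is what properness of
    the subvariety provides. *)
Lemma commutative_growth (F : fieldType) (A : comAlgType F) (t : {scalar A})
    (tC : forall a b : A, t (a * b) = t (b * a)) :
    [pchar F] =i pred0 ->
    (forall x y : A, t y *: x ^+ 3 - (3 * t (x * y)) *: x ^+ 2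
      + (3 * t (x ^+ 2 * y)) *: x - t (x ^+ 3 * y) *: 1 = 0) ->
    (forall j : A, j ^+ 2 = 0 -> t j <> 1) ->
  polynomial_growth (TrAlgebra tC).
Proof.
move=> F0 cubic noj; apply: polynomial_growth_sqr => n.
have [t0|/not_all_ex_not[y /eqP ty]] := classic (forall x, t x = 0).
  exact: trace0_codim.
have nil_tr0 (j : A) : j ^+ 3 = 0 -> t j = 0.
  move=> j3; apply/eqP/negPn/negP => tj.
  apply: (noj ((t j)^-1 *: j)); last by rewrite linearZ /= mulVf.
  by rewrite exprZn (nilpotent_traced_sqr0 F0 cubic j3 tj) scaler0.
pose y0 := (t y)^-1 *: y.
have ty0 : t y0 = 1 by rewrite linearZ /= mulVf.
have t1 := tr1_neq0 F0 cubic nil_tr0 ty0.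
apply: (@scalar_trace_codim F A t tC n (fun x => t x / t 1) (t 1)).
- by rewrite divff.
- move=> x z /=; apply: (mulfI t1); rewrite mulrA.
  rewrite (tr_quasi_mul F0 cubic nil_tr0 ty0); field.
  exact: t1.
- by move=> x; rewrite mulrC divfK.
have tj x : t (x - (t x / t 1)%:A) = 0.
  by rewrite linearB linearZ /= divfK // subrr.
by move=> x z w; apply: (tr0_mul3 F0 cubic nil_tr0 ty0).
Qed.

Theorem corollary33 (F : fieldType) (F_char0 : [pchar F] =i pred0) (e : F)
    (B : trAlgebra F) (B_fd : finite_dimensional B)
    (B_proper : proper_subvariety (var_tr B) (var_tr (C2_trAlgebra e))) :
  polynomial_growth B.
Proof.
have [/(_ B (fun _ H => H)) BC2 nsub] := B_proper.
have noj (j : B) : j ^+ 2 = 0 -> tr j <> 1.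
  move=> j2 tj; apply: nsub => A AC2 f Bf; apply: AC2.
  exact: C2_embedding j2 tj (var_C2_tr1 BC2 F_char0 j2 tj) Bf.
move: (var_C2_commutative BC2) (var_C2_cubic BC2) noj.
case: B {B_fd B_proper BC2 nsub} => S t tC mC.
have [A /= AS] := commutative_comAlgType mC.
case: S / AS t tC {mC} => t tC.
exact: commutative_growth.
Qed.
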